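(* Let $p$ be an odd prime, $q$ a power of $p$, $l\ge 0$ an integer, and $k=2$. Then $D_{p^l+1,k}(1,x)$ is a permutation polynomial of $\mathbb{F}_q$ if and only if $\gcd\big(\frac{p^l-1}{2},\,q-1\big)=1$.
   Context: For an integer $k$ with $0\le k\le p-1$ and an integer $n\ge1$, $D_{n,k}(1,x)=\sum_{i=0}^{\lfloor n/2\rfloor}\frac{n-ki}{n-i}\binom{n-i}{i}(-x)^i\in\mathbb{F}_q[x]$ (the coefficients are integers, reduced mod $p$). A permutation polynomial of $\mathbb{F}_q$ is a polynomial inducing a bijection of $\mathbb{F}_q$. *)

(* Defs.v *)
From HB Require Import structures.
From mathcomp Require Import all_boot all_order all_algebra.

Set Implicit Arguments.
Unset Strict Implicit.
Unset Printing Implicit Defensive.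

Import Order.TTheory GRing.Theory Num.Theory.

Local Open Scope ring_scope.

(* The integer (n - k i) / (n - i) * binom(n - i, i).  The numerator may be
   negative, hence the use of int; the division is exact whenever
   0 <= i <= n/2 and 1 <= n, see dickson_coefE. *)
Definition dickson_coef (n k i : nat) : int :=
  ((n%:Z - (k * i)%N%:Z) * 'C(n - i, i)%:Z %/ (n - i)%N%:Z)%Z.

(* D_{n,k}(1, x), the reversed Dickson polynomial of the (k+1)-th kind. *)
Definition revDickson (R : nzRingType) (n k : nat) : {poly R} :=
  \sum_(0 <= i < (n./2).+1) (dickson_coef n k i)%:~R *: (- 'X) ^+ i.

Definition permutation_polynomial (F : finFieldType) (f : {poly F}) : Prop :=
  bijective (fun x : F => f.[x]).

Lemma dickson_coefE (n k i : nat) : (0 < n)%N -> (i <= n./2)%N ->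
  dickson_coef n k i * (n - i)%N%:Z = (n%:Z - (k * i)%N%:Z) * 'C(n - i, i)%:Z.
Proof.
move=> n_gt0 le_i_n2; rewrite /dickson_coef divzK //.
have le_in : (i <= n)%N.
  by apply: leq_trans le_i_n2 _; rewrite -{2}(odd_double_half n) -addnn addnA leq_addl.
case: i le_i_n2 le_in => [|i] _ lt_in.
  by rewrite subn0 muln0 subr0 bin0 mulr1 dvdzz.
set m := (n - i.+1)%N.
have eq_n : n = (m + i.+1)%N by rewrite subnK.
have binE : i.+1%:Z * 'C(m, i.+1)%:Z = m%:Z * 'C(m.-1, i)%:Z.
  by rewrite -!PoszM mul_bin_diag.
have -> : (n%:Z - (k * i.+1)%N%:Z) * 'C(m, i.+1)%:Z
        = m%:Z * ('C(m, i.+1)%:Z + (1 - k%:Z) * 'C(m.-1, i)%:Z).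
  rewrite eq_n PoszD PoszM.
  have -> : m%:Z + i.+1%:Z - k%:Z * i.+1%:Z = m%:Z + (1 - k%:Z) * i.+1%:Z.
    by rewrite mulrBl mul1r addrA.
  by rewrite mulrDl -mulrA binE mulrDr [in RHS]mulrCA.
exact: dvdz_mulr.
Qed.

(* Main.v *)
Require Import Defs.
From HB Require Import structures.
From mathcomp Require Import all_boot all_order all_algebra.
From mathcomp Require Import finfield.
From mathcomp Require Import ring.

Import Order.TTheory GRing.Theory Num.Theory.

Local Open Scope ring_scope.

(** Since [(n - 2i)/(n - i) * C(n-i, i) = C(n-1-i, i)], the polynomial
    [D_{n,2}(1, x)] takes the value [(y^n - z^n)/(y - z)] at [x = y z] whenever
    [y + z = 1].  Substituting [y = (1+u)/2], [z = (1-u)/2], so [u^2 = 1 - 4x],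
    the Frobenius map gives [D_{p^l+1,2}(1, x) = (1 + u^(p^l-1))/2
    = (1 + (1-4x)^((p^l-1)/2))/2], which is affinely equivalent to a monomial. *)

Lemma dickson_coef2 (n i : nat) : (0 < n)%N -> (i <= n./2)%N ->
  dickson_coef n 2 i = 'C(n.-1 - i, i)%:Z.
Proof.
move=> n_gt0 le_i_n2.
have le_2i_n : (2 * i <= n)%N.
  rewrite mul2n -[n in (_ <= n)%N]odd_double_half.
  by rewrite (leq_trans _ (leq_addl _ _)) ?leq_double.
have lt_in : (i < n)%N.
  case: i le_2i_n {le_i_n2} => // i; apply: leq_trans.
  by rewrite mul2n -addnn addSn addnS !ltnS leq_addl.
have ni_neq0 : (n - i)%N%:Z != 0 by rewrite eqz_nat subn_eq0 -ltnNge.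
(* Clearing the denominator leaves the absorption identity
   [(n - 2i) C(n-i, i) = (n - i) C(n-i-1, i)]. *)
apply: (mulIf ni_neq0); rewrite dickson_coefE // subzn // -!PoszM.
have -> : (n.-1 - i = (n - i).-1)%N by rewrite -!subn1 subnAC.
by rewrite [in RHS]mulnC mul_bin_down mul2n -addnn subnDA.
Qed.

(** Terms past [n./2] vanish, since there [n - 1 - i < i]; the longer range suits a recurrence in
    [n]. *)
Lemma revDickson2E (R : nzRingType) (n : nat) : (0 < n)%N ->
  revDickson R n 2 = \sum_(i < n) (- 'X) ^+ i *+ 'C(n.-1 - i, i).
Proof.
move=> n_gt0; rewrite /revDickson.
rewrite -(big_mkord xpredT
  (fun i => (- 'X) ^+ i *+ 'C(n.-1 - i, i))).
have lt_n2 : (n./2 < n)%N.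
  by rewrite ltn_half_double -addnn -[X in (X < _)%N]addn0 ltn_add2l.
rewrite (big_cat_nat _ lt_n2) //= [X in _ + X]big_nat_cond.
rewrite [X in _ + X]big1 ?addr0 => [|i /andP[/andP[lt_n2i lt_in] _]]; last first.
  have i_gt0 : (0 < i)%N by apply: leq_ltn_trans lt_n2i.
  rewrite bin_small ?mulr0n // ltn_psubLR // addnn.
  by rewrite (leq_ltn_trans (leq_pred n)) // -ltn_half_double.
apply: eq_big_nat => i /andP[_ le_i].
by rewrite dickson_coef2 // -pmulrn scaler_nat.
Qed.

(** Both [y] and [z] are roots of [T^2 - T + yz], so the right side obeys
    [a_(k+2) = a_(k+1) - yz a_k]; Pascal's rule gives the sum the same recurrence. *)
Lemma sum_bin_lucas (R : comNzRingType) (y z : R) (n : nat) : y + z = 1 ->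
  (y - z) * (\sum_(i < n) (- (y * z)) ^+ i *+ 'C(n.-1 - i, i)) = y ^+ n - z ^+ n.
Proof.
move=> yz1; set t := - (y * z).
pose G k := \sum_(i < k) t ^+ i *+ 'C(k.-1 - i, i).
have GSS k : G k.+2 = G k.+1 + t * G k.
  rewrite /G [LHS]big_ord_recl [in RHS]big_ord_recl /= !expr0 !bin0 -addrA.
  congr (_ + _); rewrite [LHS]big_ord_recr /= /bump /=.
  (* The last term of [G k.+2] carries [C(0, k+1) = 0]. *)
  rewrite !add1n subSS subnn bin0n mulr0n addr0.
  rewrite mulr_sumr -big_split /=; apply: eq_bigr => i _.
  rewrite /bump /= !add1n subSS.
  have -> : (k - i = (k.-1 - i).+1)%N.
    by case: k i => [[]|k] //= i; rewrite subSn // -ltnS.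
  have -> : (k - i.+1 = k.-1 - i)%N by rewrite -subn1 -subnDA add1n.
  by rewrite binS mulrnDr mulrnAr -exprS.
rewrite -/(G n).
suff: (y - z) * G n = y ^+ n - z ^+ n /\
      (y - z) * G n.+1 = y ^+ n.+1 - z ^+ n.+1.
  by case.
elim: n => [|n [IH0 IH1]].
  by rewrite /G big_ord0 big_ord_recl big_ord0 /= bin0 !expr0 !expr1; split; ring.
split=> //; rewrite GSS mulrDr IH1 mulrCA IH0 /t !exprS.
have -> : z = 1 - y by rewrite -yz1; ring.
ring.
Qed.

(** To have a square root of [1 - 4x] at hand, both sides are composed with [g = (1 - X^2)/4], which
    turns [1 - 4x] into [X^2]; the indeterminate then plays the role of [u]. *)
Lemma revDickson2_pchar (F : fieldType) (p l : nat) :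
  p \in [pchar F] -> odd p ->
  revDickson F (p ^ l + 1)%N 2 =
    2%:R^-1 *: (1 + (1 - 4%:R *: 'X) ^+ ((p ^ l - 1) %/ 2)%N).
Proof.
move=> pcharFp odd_p; have p_pr := pcharf_prime pcharFp.
have odd_q : odd (p ^ l) by rewrite oddX odd_p orbT.
have pnat_q (R : nzRingType) : p \in [pchar R] -> [pchar R].-nat (p ^ l)%N.
  by move=> pcharRp; rewrite pnatX (eq_pnat _ (pcharf_eq pcharRp)) pnat_id.
have pcharXp : p \in [pchar {poly F}] by rewrite pchar_poly.
set q := (p ^ l)%N in odd_q pnat_q *; set m := ((q - 1) %/ 2)%N.
have qE : q = (2 * m).+1.
  rewrite /m divn2 mul2n -[q in LHS]odd_double_half odd_q.
  by rewrite -[in RHS](odd_double_half q) odd_q add1n subn1 /= doubleK.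
have two_neq0 : 2%:R != 0 :> F.
  by rewrite -(dvdn_pcharf pcharFp) dvdn_prime2 // gtn_eqF // odd_prime_gt2.
set c : F := 2%:R^-1.
have cE : c * 2%:R = 1 by rewrite mulVf.
(* The inverse of 2 lies in the prime field, so Frobenius fixes it. *)
have c_q : c ^+ q = c.
  by rewrite exprVn mulr2n (exprDn_pchar _ _ (pnat_q _ pcharFp)) expr1n.
pose g : {poly F} := c%:P ^+ 2 * (1 - 'X ^+ 2).
have size_g : (1 < size g)%N.
  rewrite /g -polyC_exp mul_polyC size_scale ?expf_neq0 ?invr_neq0 //.
  by rewrite addrC size_polyDl ?size_polyN ?size_polyXn ?size_poly1.
(* Composition with the nonconstant [g] is injective. *)
apply/eqP; rewrite -subr_eq0 -(comp_poly_eq0 _ size_g) rmorphB subr_eq0 /=.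
apply/eqP.
have cPE : c%:P * 2%:R = 1 :> {poly F} by rewrite -polyC_natr -polyCM cE.
have X_neq0 : 'X != 0 :> {poly F} by rewrite polyX_eq0.
(* The extra factor ['X] is the [y - z] required by [sum_bin_lucas]. *)
apply: (mulfI X_neq0).
pose y : {poly F} := c%:P * (1 + 'X); pose z : {poly F} := c%:P * (1 - 'X).
have yz1 : y + z = 1 by rewrite -cPE /y /z; ring.
have yBz : y - z = 'X.
  by rewrite -[RHS]mul1r -cPE /y /z; ring.
have gE : g = y * z by rewrite /g /y /z; ring.
rewrite revDickson2E ?addn1 // linear_sum /=.
under eq_bigr => i _ do rewrite linearMn /= rmorphXn rmorphN /= comp_polyX gE.
rewrite -[X in X * _ = _]yBz sum_bin_lucas // !exprSr /y /z !exprMn.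
(* Frobenius gives [y^q = c (1 + X^q)] and, as [q] is odd, [z^q = c (1 - X^q)]. *)
rewrite -polyC_exp c_q !(exprDn_pchar _ _ (pnat_q _ pcharXp)) expr1n.
rewrite exprNn -signr_odd odd_q expr1.
rewrite comp_polyZ comp_polyD rmorphXn /= comp_polyB.
rewrite -polyC1 !comp_polyC comp_polyZ comp_polyX polyC1.
have -> : 1 - 4%:R *: g = 'X ^+ 2.
  rewrite -mul_polyC polyC_natr /g.
  have -> : 1 - 4%:R * (c%:P ^+ 2 * (1 - 'X ^+ 2))
    = 1 - (c%:P * 2%:R) ^+ 2 * (1 - 'X ^+ 2) :> {poly F} by ring.
  by rewrite cPE; ring.
rewrite -exprM -mul_polyC qE exprSr.
set P := 'X ^+ _.
transitivity (c%:P * (c%:P * 2%:R) * ('X + P * 'X)); first by ring.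
by rewrite cPE; ring.
Qed.

(** Root counting gives one direction, Bezout the other. The field with two elements is excluded
    because there [m = 0] has gcd 1 but a constant map. *)
Lemma expf_injective_iff (F : finFieldType) (m : nat) : (2 < #|F|)%N ->
  injective (fun x : F => x ^+ m) <-> gcdn m (#|F| - 1) = 1%N.
Proof.
rewrite subn1 => card_gt2; set N := #|F|.-1.
have N_gt1 : (1 < N)%N by rewrite /N; case: #|F| card_gt2.
have expN (x : F) : x != 0 -> x ^+ N = 1.
  move=> x_neq0; apply: (mulfI x_neq0); rewrite -exprS mulr1.
  by rewrite prednK ?expf_card // ltnW // ltnW.
split=> [inj_m | gcd1 x y /= eq_xy].
  set d := gcdn m N; have d_gt0 : (0 < d)%N by rewrite gcdn_gt0 (ltnW N_gt1) orbT.
  pose s := (N %/ d)%N.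
  have sdN : (s * d = N)%N by rewrite divnK // dvdn_gcdr.
  have s_gt0 : (0 < s)%N by case: posnP sdN N_gt1 => // -> <-.
  have exps (x : F) : x != 0 -> x ^+ s = 1.
    move=> x_neq0; apply: inj_m; rewrite expr1n -exprM.
    have /dvdnP[k ->] : (N %| s * m)%N by rewrite -sdN dvdn_mul // dvdn_gcdl.
    by rewrite mulnC exprM expN // expr1n.
  (* All [N] nonzero elements are roots of [X^s - 1], which forces [d = 1]. *)
  have le_Ns : (N <= s)%N.
    have -> : N = size (enum (predC1 (0 : F))) by rewrite -cardE cardC1.
    apply: max_unity_roots; rewrite ?enum_uniq //.
    by apply/allP => x; rewrite mem_enum unity_rootE => /exps ->.
  by apply/eqP; rewrite eqn_leq d_gt0 andbT -(leq_pmul2l s_gt0) sdN muln1.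
have m_gt0 : (0 < m)%N by case: posnP gcd1 N_gt1 => // ->; rewrite gcd0n => ->.
have [y0 | y_neq0] := eqVneq y 0.
  by apply/eqP; move/eqP: eq_xy; rewrite y0 expr0n gtn_eqF // expf_eq0 m_gt0.
have x_neq0 : x != 0.
  apply: contraNneq y_neq0 => x0; move/eqP: eq_xy.
  by rewrite x0 expr0n gtn_eqF // eq_sym expf_eq0 m_gt0.
have xy_m : (x / y) ^+ m = 1 by rewrite expr_div_n eq_xy divff ?expf_neq0.
(* Bezout: [km m = kn N + 1]; raising [x / y] to both sides gives [x / y = 1]. *)
have [km kn eq_km _] := egcdnP N m_gt0.
apply: (divIf y_neq0); rewrite divff //.
have := congr1 (fun k => (x / y) ^+ k) eq_km; rewrite /= gcd1 exprD expr1.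
rewrite mulnC exprM xy_m expr1n mulnC exprM expN ?mulf_neq0 ?invr_neq0 //.
by rewrite expr1n mul1r.
Qed.

Theorem theorem2p12 (p e q l : nat) (F : finFieldType) :
  prime p -> odd p -> (0 < e)%N -> q = (p ^ e)%N -> #|F| = q ->
  permutation_polynomial (revDickson F (p ^ l + 1)%N 2) <->
  gcdn ((p ^ l - 1) %/ 2)%N (q - 1)%N = 1%N.
Proof.
move=> p_pr odd_p e_gt0 -> cardF; rewrite -cardF.
have pcharFp := card_finPcharP cardF p_pr.
have p_gt2 := odd_prime_gt2 odd_p p_pr.
have card_gt2 : (2 < #|F|)%N.
  by rewrite cardF (leq_trans p_gt2) // -[X in (X <= _)%N]expn1 leq_exp2l // ltnW.
have two_neq0 : 2%:R != 0 :> F.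
  by rewrite -(dvdn_pcharf pcharFp) dvdn_prime2 // gtn_eqF.
have four_neq0 : 4%:R != 0 :> F by rewrite (natrM _ 2 2) mulf_neq0.
rewrite -expf_injective_iff //; set m := (_ %/ 2)%N.
have hornerE x : (revDickson F (p ^ l + 1)%N 2).[x] =
    2%:R^-1 * (1 + (1 - 4%:R * x) ^+ m).
  by rewrite (revDickson2_pchar _ _ _ pcharFp odd_p) !hornerE.
split=> [/bij_inj inj_D u v /= eq_uv | inj_m].
  (* [h] inverts [x -> 1 - 4x], which carries injectivity over to the power map. *)
  pose h u : F := (1 - u) / 4%:R.
  have hK w : 1 - 4%:R * h w = w by rewrite /h mulrC divfK //; ring.
  rewrite -[u]hK -[v]hK; congr (1 - 4%:R * _); apply: inj_D.
  by rewrite !hornerE !hK eq_uv.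
apply: injF_bij => u v; rewrite !hornerE.
by move/(mulfI (invr_neq0 two_neq0))/addrI/inj_m/addrI/oppr_inj/(mulfI four_neq0).
Qed.
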